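(* Let $p=3$. There is a well-defined homeomorphism $$\Psi:3\mathbb{Z}_3\cup(1+3\mathbb{Z}_3)\longrightarrow U^{(1)}-U^{(2)}$$ given by $\Psi(0)=q_0$, $\Psi(1)=q_1$, and, for $z\in \big(3\mathbb{Z}_3\cup(1+3\mathbb{Z}_3)\big)-\{0,1\}$, $\Psi(z)=q$, where $q\in U^{(1)}-U^{(2)}$ is the unique element such that $\iota_q(z)=z$.
   Context: $\mathbb{Z}_3$ is the ring of $3$-adic integers, $U^{(m)}=1+3^m\mathbb{Z}_3$, and all sets carry the subspace topology from $\mathbb{Z}_3$. For $q\in U^{(1)}$, $\iota_q:\mathbb{Z}_3\to\mathbb{Z}_3$ is the unique continuous function with $\iota_q(n)=1+q+\cdots+q^{n-1}$ for all integers $n\ge 0$; thus $\iota_q(z)=(q^z-1)/(q-1)$ for $q\ne 1$. A $3$-adic fixed point is $z\in\mathbb{Z}_3$ with $\iota_q(z)=z$; the fixed points $0,1$ are called trivial. $q_0$ and $q_1$ denote the unique elements of $U^{(1)}-U^{(2)}$ with $q_0\equiv 7\pmod 9$ and $q_1\equiv 4\pmod 9$ such that $\iota_{q_0}$ and $\iota_{q_1}$ have no nontrivial $3$-adic fixed points (their existence and uniqueness is a result of the same paper). *)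

(* Defs.v *)
From HB Require Import structures.
From mathcomp Require Import all_boot all_order all_algebra.
From mathcomp Require Import all_classical all_reals all_analysis.
From mathcomp Require Import zify ring.

Set Implicit Arguments.
Unset Strict Implicit.
Unset Printing Implicit Defensive.

Import GRing.Theory.
Local Open Scope classical_set_scope.
Local Open Scope ring_scope.

(* Z_3 as the inverse limit of the rings Z/3^n: residue x n is the            *)
(* representative in [0, 3^n[ of x mod 3^n. The single condition residueP     *)
(* says both that residue x n < 3^n and that the residues are compatible.     *)
Record Z3 := MkZ3 {
  residue :> nat -> nat;
  residueP : forall n, residue n = (residue n.+1 %% 3 ^ n)%N }.

HB.instance Definition _ := gen_eqMixin Z3.
HB.instance Definition _ := gen_choiceMixin Z3.

Lemma Z3_ext (x y : Z3) : (forall n, x n = y n) -> x = y.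
Proof.
case: x y => [u hu] [v hv] /= /funext uv; rewrite {}uv in hu *.
by congr MkZ3; exact: Prop_irrelevance.
Qed.

Lemma residue_mod (x : Z3) n : (x n %% 3 ^ n)%N = x n.
Proof. by rewrite residueP modn_mod. Qed.

Lemma residueS (x : Z3) n : (x n.+1 = x n %[mod 3 ^ n])%N.
Proof. by rewrite (residueP x n) modn_mod. Qed.

Lemma of_compatible_subproof (u : nat -> nat)
    (hu : forall n, (u n.+1 = u n %[mod 3 ^ n])%N) n :
  (u n %% 3 ^ n = (u n.+1 %% 3 ^ n.+1) %% 3 ^ n)%N.
Proof. by rewrite modn_dvdm ?hu // dvdn_exp2l. Qed.

Definition of_compatible (u : nat -> nat)
    (hu : forall n, (u n.+1 = u n %[mod 3 ^ n])%N) : Z3 :=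
  MkZ3 (of_compatible_subproof hu).

Section Ring.
Implicit Types x y z : Z3.

Lemma addZ3_subproof x y n : (x n.+1 + y n.+1 = x n + y n %[mod 3 ^ n])%N.
Proof. by rewrite -modnDm !residueS modnDm. Qed.

Lemma mulZ3_subproof x y n : (x n.+1 * y n.+1 = x n * y n %[mod 3 ^ n])%N.
Proof. by rewrite -modnMm !residueS modnMm. Qed.

Lemma leq_residue x n : (x n <= 3 ^ n)%N.
Proof. by rewrite -residue_mod ltnW // ltn_mod expn_gt0. Qed.

Lemma oppZ3_subproof x n : (3 ^ n.+1 - x n.+1 = 3 ^ n - x n %[mod 3 ^ n])%N.
Proof.
apply/eqP; rewrite -(eqn_modDr (x n.+1)) subnK ?leq_residue //.
rewrite -modnDmr residueS modnDmr subnK ?leq_residue //.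
by rewrite modnn expnS modnMl.
Qed.

Definition natZ3 (k : nat) := @of_compatible (fun=> k) (fun=> erefl).
Definition addZ3 x y := of_compatible (addZ3_subproof x y).
Definition mulZ3 x y := of_compatible (mulZ3_subproof x y).
Definition oppZ3 x := of_compatible (oppZ3_subproof x).

Lemma addZ3A : associative addZ3.
Proof. by move=> x y z; apply: Z3_ext => n /=; rewrite modnDml modnDmr addnA. Qed.

Lemma addZ3C : commutative addZ3.
Proof. by move=> x y; apply: Z3_ext => n /=; rewrite addnC. Qed.

Lemma add0Z3 : left_id (natZ3 0) addZ3.
Proof.
by move=> x; apply: Z3_ext => n /=; rewrite modnDml add0n residue_mod.
Qed.

Lemma addNZ3 : left_inverse (natZ3 0) oppZ3 addZ3.
Proof.
move=> x; apply: Z3_ext => n /=.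
by rewrite modnDml subnK ?leq_residue // modnn mod0n.
Qed.

HB.instance Definition _ :=
  GRing.isZmodule.Build Z3 addZ3A addZ3C add0Z3 addNZ3.

Lemma mulZ3A : associative mulZ3.
Proof. by move=> x y z; apply: Z3_ext => n /=; rewrite modnMml modnMmr mulnA. Qed.

Lemma mulZ3C : commutative mulZ3.
Proof. by move=> x y; apply: Z3_ext => n /=; rewrite mulnC. Qed.

Lemma mul1Z3 : left_id (natZ3 1) mulZ3.
Proof.
by move=> x; apply: Z3_ext => n /=; rewrite modnMml mul1n residue_mod.
Qed.

Lemma mulZ3Dl : left_distributive mulZ3 (+%R : Z3 -> Z3 -> Z3).
Proof.
by move=> x y z; apply: Z3_ext => n /=; rewrite modnMml modnDm mulnDl.
Qed.

Lemma oneZ3_neq0 : natZ3 1 != 0.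
Proof. by apply/eqP => /(congr1 (fun x : Z3 => x 1%N)). Qed.

HB.instance Definition _ :=
  GRing.Zmodule_isComNzRing.Build Z3 mulZ3A mulZ3C mul1Z3 mulZ3Dl oneZ3_neq0.

Lemma residueD x y n : (x + y) n = ((x n + y n) %% 3 ^ n)%N.
Proof. by []. Qed.

Lemma residueM x y n : (x * y) n = ((x n * y n) %% 3 ^ n)%N.
Proof. by []. Qed.

Lemma residue_nat k n : (k%:R : Z3) n = (k %% 3 ^ n)%N.
Proof.
elim: k => [|k IHk] //.
by rewrite -natr1 residueD IHk (_ : residue 1 n = (1 %% 3 ^ n)%N) // modnDm addn1.
Qed.

Lemma residueX x k n : (x ^+ k) n = (x n ^ k %% 3 ^ n)%N.
Proof.
by elim: k => [|k IHk] //; rewrite exprS residueM IHk modnMmr expnS.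
Qed.

Lemma residue_sum k (F : nat -> Z3) n :
  residue (\sum_(i < k) F i) n = ((\sum_(i < k) F i n)%N %% 3 ^ n)%N.
Proof.
elim: k => [|k IHk]; first by rewrite !big_ord0.
by rewrite !big_ord_recr residueD IHk modnDml.
Qed.

End Ring.

HB.instance Definition _ := isPointed.Build Z3 0.

(* The inverse limit topology, each Z/3^n being discrete. *)
HB.instance Definition _ :=
  Uniform.copy Z3 (initial_topology (residue : Z3 -> {ptws nat -> nat})).

Lemma residue_leq (x : Z3) m n : (m <= n)%N -> x m = (x n %% 3 ^ m)%N.
Proof.
elim: n => [|n IHn]; first by rewrite leqn0 => /eqP ->; rewrite residue_mod.
rewrite leq_eqVlt => /orP[/eqP -> |]; first by rewrite residue_mod.
rewrite ltnS => mn; rewrite (IHn mn) (residueP x n) modn_dvdm //.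
exact: dvdn_exp2l.
Qed.

Lemma nbhs_Z3P (x : Z3) (A : set Z3) :
  nbhs x A <-> exists n, forall y : Z3, y n = x n -> A y.
Proof.
split=> [|[n xA]]; last first.
  have /= := @proj_continuous nat (fun=> nat) n (residue x).
  have xn1 : nbhs (x n) [set x n] by apply/principal_filterP.
  move=> /(_ _ xn1) /= xn.
  have := @initial_continuous Z3 {ptws nat -> nat} residue x _ xn.
  rewrite nbhs_simpl /= => xnx.
  by apply: (@filterS Z3 (nbhs x) _ _ A _ xnx) => y; exact: xA.
move=> [_ [[B oB <-] Bx BA]]; apply: contrapT => /forallNP nA.
have {}nA n : exists y : Z3, y n = x n /\ ~ A y.
  by move: (nA n) => /existsNP[y /not_implyP yA]; exists y.
have [y yP] := choice nA.
have yx : (residue \o y) @ \oo --> (residue x : {ptws nat -> nat}).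
  apply/cvg_sup => m; apply/cvg_image => /=.
    by apply/seteqP; split=> // k _; exists (fun=> k).
  move=> C /principal_filterP Cx; exists (fun f => C (f m)); last first.
    apply/seteqP; split=> [_ [f ? <-] //|k Ck].
    by exists (fun=> k).
  exists m => //= n mn; rewrite /preimage /=; suff -> : residue (y n) m = x m by [].
  by rewrite (residue_leq (y n) mn) (yP n).1 -residue_leq.
have [N _ /(_ N (leqnn N)) /= BN] : \forall n \near \oo, B (residue (y n)).
  exact: yx _ (open_nbhs_nbhs (conj oB Bx)).
by apply: (yP N).2; exact: BA.
Qed.

Lemma continuous_Z3P (f : Z3 -> Z3) : continuous f <->
  forall (x : Z3) m, exists n, forall y : Z3, y n = x n -> f y m = f x m.
Proof.
split=> [cf x m|cf x A /nbhs_Z3P[m mA]].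
  have /cf /nbhs_Z3P[n nP] : nbhs (f x) [set z : Z3 | z m = f x m].
    by apply/nbhs_Z3P; exists m.
  by exists n.
have [n nP] := cf x m; apply/nbhs_Z3P; exists n => y /nP.
exact: mA.
Qed.

(* a + 3^m Z_3 *)
Definition residue_class (a : Z3) (m : nat) : set Z3 :=
  [set a + 3 ^+ m * y | y in [set: Z3]].

Definition principal_units (m : nat) : set Z3 := residue_class 1 m.

Definition is_iota (q : Z3) (f : Z3 -> Z3) : Prop :=
  continuous f /\ forall n : nat, f n%:R = \sum_(i < n) q ^+ i.

Lemma is_iota_uniq (q : Z3) (f g : Z3 -> Z3) :
  is_iota q f -> is_iota q g -> f = g.
Proof.
move=> [/continuous_Z3P cf fq] [/continuous_Z3P cg gq].
apply/funext => x; apply: Z3_ext => m.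
have [i iP] := cf x m; have [j jP] := cg x m.
have xn k : (k <= maxn i j)%N -> ((x (maxn i j))%:R : Z3) k = x k.
  by move=> /(residue_leq x) ->; rewrite residue_nat.
by rewrite -(iP _ (xn i (leq_maxl _ _))) -(jP _ (xn j (leq_maxr _ _))) fq gq.
Qed.

Section IotaExists.
Local Open Scope nat_scope.
Implicit Types a b k n r : nat.

Let geom r k := \sum_(i < k) r ^ i.

Let geomD r a b : geom r (a + b) = geom r a + r ^ a * geom r b.
Proof.
rewrite /geom big_split_ord /= big_distrr /=; congr addn.
by apply: eq_bigr => i _; rewrite expnD.
Qed.

Let geom_dvd r n : r = 1 %[mod 3] -> 3 ^ n %| geom r (3 ^ n).
Proof.
move=> r1; elim: n => [|n IHn]; first exact: dvd1n.
have -> : geom r (3 ^ n.+1) =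
    geom r (3 ^ n) * (1 + r ^ 3 ^ n + r ^ 3 ^ n * r ^ 3 ^ n).
  rewrite (_ : 3 ^ n.+1 = 3 ^ n + (3 ^ n + 3 ^ n)); last by rewrite expnS; lia.
  by rewrite !geomD; ring.
rewrite expnSr dvdn_mul // /dvdn.
have rX : r ^ 3 ^ n %% 3 = 1 by rewrite -modnXm r1 modnXm exp1n.
by rewrite -modnDm -(modnDm 1) -modnMm rX.
Qed.

Let geom_mod r a b n :
  r = 1 %[mod 3] -> a = b %[mod 3 ^ n] -> geom r a = geom r b %[mod 3 ^ n].
Proof.
move=> r1; wlog ba : a b / b <= a.
  move=> wl ab; have [/wl|/ltnW /wl] := leqP b a; first exact.
  by move=> /(_ (esym ab)).
move=> /eqP; rewrite eqn_mod_dvd // => /dvdnP[c abc].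
have {abc ba} -> : a = b + c * 3 ^ n by rewrite -abc subnKC.
elim: c => [|c <-]; first by rewrite mul0n addn0.
rewrite mulSn addnCA addnC geomD.
have /dvdnP[d ->] := geom_dvd n r1.
by rewrite mulnA addnC modnMDl.
Qed.

Let geom_base r s k n : r = s %[mod n] -> geom r k = geom s k %[mod n].
Proof.
move=> rs; rewrite /geom; elim: k => [|k IHk]; first by rewrite !big_ord0.
by rewrite !big_ord_recr /= -modnDm IHk -(modnXm k n r) rs modnXm modnDm.
Qed.

Let iota_compatible (q : Z3) : q 1 = 1 -> forall (z : Z3) n,
  geom (q n.+1) (z n.+1) = geom (q n) (z n) %[mod 3 ^ n].
Proof.
move=> q1 z n; rewrite (geom_base _ (residueS q n)).
case: n => [|n]; first by rewrite !modn1.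
apply: geom_mod (residueS z n.+1).
by rewrite -[LHS](@residue_leq q 1 n.+1).
Qed.

Lemma is_iota_ex (q : Z3) : principal_units 1 q -> exists f, is_iota q f.
Proof.
move=> [y _ qE]; have q1 : q 1 = 1.
  rewrite -qE residueD expr1 residueM (residue_nat 3).
  by rewrite modnn mul0n mod0n.
exists (fun z => of_compatible (iota_compatible q1 z)); split.
  by apply/continuous_Z3P => x m; exists m => y' /= ->.
move=> k; apply: Z3_ext => n.
have -> : (\sum_(i < k) q ^+ i)%R n = geom (q n) k %% 3 ^ n.
  rewrite (residue_sum k (fun i => (q ^+ i)%R)) -modn_summ /=.
  under eq_bigr do rewrite residueX modn_mod.
  by rewrite modn_summ.
case: n => [|n]; first by rewrite /= !modn1.
rewrite /= residue_nat; apply: geom_mod; last by rewrite modn_mod.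
by rewrite -[LHS](@residue_leq q 1 n.+1).
Qed.

End IotaExists.

(* By is_iota_ex and is_iota_uniq, for q in 1 + 3 Z_3 this is the unique      *)
(* continuous function with value 1 + q + ... + q^(n-1) at n : nat.           *)
Definition iota_q (q : Z3) : Z3 -> Z3 := get (is_iota q).

Lemma iota_qP (q : Z3) : principal_units 1 q -> is_iota q (iota_q q).
Proof. by move=> /is_iota_ex; exact: getPex. Qed.

Definition fixed_point (q z : Z3) : Prop := iota_q q z = z.

Definition PsiDom : set Z3 := residue_class 0 1 `|` residue_class 1 1.

Definition PsiCod : set Z3 := principal_units 1 `\` principal_units 2.

Definition no_nontrivial_fixed_point (q : Z3) : Prop :=
  forall z, fixed_point q z -> z = 0 \/ z = 1.

(* The definite descriptions default to 0, which is outside PsiCod. *)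
Definition q0 : Z3 := get [set q | [/\ PsiCod q, residue_class 7 2 q
  & no_nontrivial_fixed_point q]].

Definition q1 : Z3 := get [set q | [/\ PsiCod q, residue_class 4 2 q
  & no_nontrivial_fixed_point q]].

Definition homeomorphism (S T : topologicalType) (f : S -> T) : Prop :=
  exists g : T -> S, [/\ cancel f g, cancel g f, continuous f & continuous g].

(* Main.v *)
(* Write q = 1 + 3u with u a unit, and expand q^n binomially. Since the       *)
(* numbers 2 3^j / (j+2)! are 3-adic integers, one gets                       *)
(*   2 (iota_q(z) - z) = 3 u z (z - 1) (1 - (2 - z) u + 3 T(2 - z, u)),       *)
(* where T(w, u) is the 3-adically convergent series                          *)
(*   T(w, u) = sum_j (2 3^(j+1) / (j+4)!) prod_(i < j+2) (- w - i) u^(j+2),   *)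
(* first for z a natural number, then for all z by density. Nontrivial fixed  *)
(* points are thus the solutions of w u = 1 + 3 T(w, u) with w = 2 - z. The   *)
(* integer coefficients make T 1-Lipschitz in each variable, so for a unit w  *)
(* the equation has exactly one solution u, which is a unit depending         *)
(* continuously on w, and symmetrically with w and u exchanged. Now w is a    *)
(* unit iff z is 0 or 1 mod 3. The elements q_0 and q_1 are those matched     *)
(* with z = 0 and z = 1, where the root of the last factor is trivial.        *)
Require Import Defs.
From mathcomp Require Import all_boot all_order all_algebra.
From mathcomp Require Import all_classical all_reals all_analysis.
From mathcomp Require Import zify ring.
Import GRing.Theory.
Local Open Scope classical_set_scope.
Local Open Scope ring_scope.

Set Implicit Arguments.
Unset Strict Implicit.
Unset Printing Implicit Defensive.

Implicit Types a x y z q w u : Z3.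

(** * Congruences modulo powers of 3 *)

(** The map and its inverse are both read off one relation, [matched z q]: for q = 1 + 3u it says
    that z is a root of the last factor in [iota_tail]. As Z_3 is a domain ([mulZ3_eq0]), the fixed
    points of iota_q are 0, 1 and the z matched with q ([fixed_point_matched]). With w = 2 - z the
    relation reads w u = 1 + 3 [tail w u], where w and u play symmetric roles. So [unit_equation_ex]
    and [unit_equation_continuous], used once with coefficient w and once with coefficient u, show
    that [matched] is the graph of a bijection continuous in both directions. If z is 0 or 1, the
    matched q has no other fixed point, and its residue mod 9 tells q_0 from q_1. *)

Lemma residue_eqD n (x x' y y' : Z3) :
  x n = x' n -> y n = y' n -> (x + y) n = (x' + y') n.
Proof. by rewrite !residueD => -> ->. Qed.

Lemma residue_eqM n (x x' y y' : Z3) :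
  x n = x' n -> y n = y' n -> (x * y) n = (x' * y') n.
Proof. by rewrite !residueM => -> ->. Qed.

Lemma residue_eqN n (x x' : Z3) : x n = x' n -> (- x) n = (- x') n.
Proof. by move=> xx'; rewrite /= xx'. Qed.

Lemma residue_eqX n k (x x' : Z3) : x n = x' n -> (x ^+ k) n = (x' ^+ k) n.
Proof. by rewrite !residueX => ->. Qed.

Lemma residue_eq_prod n k (F F' : nat -> Z3) :
  (forall i, F i n = F' i n) ->
  (\prod_(i < k) F i) n = (\prod_(i < k) F' i) n.
Proof.
move=> FF'; elim: k => [|k IHk]; first by rewrite !big_ord0.
by rewrite !big_ord_recr; exact: residue_eqM.
Qed.

Lemma residue_eq_sum n k (F F' : nat -> Z3) :
  (forall i, F i n = F' i n) ->
  (\sum_(i < k) F i) n = (\sum_(i < k) F' i) n.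
Proof.
move=> FF'; elim: k => [|k IHk]; first by rewrite !big_ord0.
by rewrite !big_ord_recr; exact: residue_eqD.
Qed.

Lemma residue_eq_leq m n x y : (m <= n)%N -> x n = y n -> x m = y m.
Proof. by move=> mn xy; rewrite !(residue_leq _ mn) xy. Qed.

Lemma residue_eqB n x y : x n = y n <-> (x - y) n = 0%N.
Proof.
split=> [xy|xy0]; first by rewrite (residue_eqD xy (erefl _)) subrr /= mod0n.
by rewrite -[x](subrK y) residueD xy0 add0n residue_mod.
Qed.

Lemma residue_pow3M k n x : (3 ^+ k * x) (n + k)%N = (3 ^ k * x n)%N.
Proof.
rewrite residueM residueX (residue_nat 3) modnXm modnMml.
by rewrite addnC expnD -muln_modr addnC -(residue_leq x (leq_addr k n)).
Qed.

Lemma residue_3M n x : (3 * x) n.+1 = (3 * x n)%N.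
Proof. by have := residue_pow3M 1 n x; rewrite addn1. Qed.

Lemma residue_eq_3M n x y : x n = y n -> (3 * x) n.+1 = (3 * y) n.+1.
Proof. by rewrite !residue_3M => ->. Qed.

Lemma residue_eq0_pow3 k x : x k = 0%N -> exists w, x = 3 ^+ k * w.
Proof.
move=> xk0.
have dx n : (3 ^ k * (x (n + k) %/ 3 ^ k) = x (n + k))%N.
  rewrite mulnC divnK //; apply/eqP.
  by rewrite -(residue_leq x (leq_addl n k)) xk0.
have wP n : (x (n.+1 + k) %/ 3 ^ k = x (n + k) %/ 3 ^ k %[mod 3 ^ n])%N.
  apply/eqP; rewrite -(eqn_pmul2l (expn_gt0 3 k : 0 < 3 ^ k)%N) !muln_modr.
  rewrite !dx -expnD addnC addnC.
  by rewrite [(k + n)%N]addnC residueS.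
exists (of_compatible wP); apply: Z3_ext => n.
apply: (@residue_eq_leq n (n + k)); first exact: leq_addr.
rewrite residue_pow3M /= muln_modr dx -expnD addnC residue_mod //.
Qed.

Lemma residue_eq_mulI n a x y :
  a 1%N != 0%N -> (a * x) n = (a * y) n -> x n = y n.
Proof.
move=> a1 /residue_eqB; rewrite -mulrBr residueM => axy; apply/residue_eqB.
rewrite -residue_mod; apply/eqP; rewrite -/(dvdn _ _).
case: n axy => [|n] axy; first by rewrite dvd1n.
rewrite -(@Gauss_dvdr _ (a n.+1)); first by rewrite /dvdn axy.
rewrite coprime_sym coprime_pexpr // coprime_sym prime_coprime // /dvdn.
by rewrite -[3%N]expn1 -(residue_leq a (ltn0Sn n)).
Qed.

(** A nonzero x is a power of 3 times a unit, and both can be cancelled. *)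
Lemma mulZ3_eq0 x y : x * y = 0 -> x = 0 \/ y = 0.
Proof.
move=> xy0; apply: contrapT => /not_orP[x0 y0].
have [k xk] : exists k, x k != 0%N.
  apply: contrapT => /forallNP xN; apply: x0; apply: Z3_ext => n.
  by have /negP := xN n; rewrite negbK => /eqP ->; rewrite /= mod0n.
have [k' xk' xSk'] : exists2 k', x k' = 0%N & x k'.+1 != 0%N.
  elim: k xk => [|k IHk]; first by rewrite -residue_mod modn1.
  by case: (eqVneq (x k) 0%N) => [xk0 xk1|/IHk //]; exists k.
have [w xE] := residue_eq0_pow3 xk'.
apply: y0; apply: Z3_ext => n.
apply: (@residue_eq_mulI n w).
  apply: contra xSk' => /eqP w1.
  by rewrite xE -[k'.+1]add1n residue_pow3M w1 muln0.
have : (x * y) (n + k')%N = 0%N by rewrite xy0 /= mod0n.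
rewrite xE -mulrA residue_pow3M mulr0 => /eqP.
rewrite muln_eq0 expn_eq0 /= => /eqP ->.
by rewrite /= mod0n.
Qed.

(** * Equations a x = 1 + 3 F(x) with a unit coefficient *)

(** Each iteration of T from 0 settles one more digit, so the diagonal sequence of residues is
    compatible and defines the fixed point. *)
Lemma contraction_fixpoint (T : Z3 -> Z3) :
  (forall n x y, x n = y n -> T x n.+1 = T y n.+1) -> exists x, T x = x.
Proof.
move=> cT; pose X k := iter k T 0.
have XS k : X k.+1 k = X k k.
  elim: k => [|k IHk]; last exact: cT.
  by rewrite -[LHS]residue_mod -[RHS]residue_mod !modn1.
have XP n : (X n.+1 n.+1 = X n n %[mod 3 ^ n])%N.
  by rewrite residueS XS.
exists (of_compatible XP); apply: Z3_ext => n.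
apply: (@residue_eq_leq n n.+1) => //.
rewrite (@cT n _ (X n)) /=; last by rewrite residue_mod.
by rewrite residue_mod.
Qed.

(* The map x |-> x - a (a x - 1 - 3 F x) is a contraction, as a^2 = 1 mod 3.  *)
Lemma unit_equation_ex a (F : Z3 -> Z3) : a 1%N != 0%N ->
  (forall n x y, x n = y n -> F x n = F y n) -> exists x, a * x = 1 + 3 * F x.
Proof.
move=> a1 cF.
have [b aE] : exists b, 1 - a * a = 3 * b.
  apply: (@residue_eq0_pow3 1); apply/residue_eqB; rewrite residueM.
  have := residue_mod a 1; rewrite expn1.
  case: (a 1%N) a1 => [|[|[|m]]] //= _ am.
  by have := ltn_pmod m.+3 (isT : 0 < 3)%N; rewrite am.
have [x xE] : exists x, a * (1 + 3 * F x) + 3 * b * x = x.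
  apply: contraction_fixpoint => n x y xy.
  apply: residue_eqD.
    apply: residue_eqM => //; apply: residue_eqD => //.
    exact: residue_eq_3M (cF _ _ _ xy).
  by rewrite -!mulrA; apply: residue_eq_3M; exact: residue_eqM.
exists x; apply: Z3_ext => n; apply: (residue_eq_mulI a1).
congr (residue _ n).
have -> : a * (1 + 3 * F x) = x - 3 * b * x by rewrite -{2}xE addrK.
by rewrite -aE; ring.
Qed.

(** Agreement mod 3^k improves to mod 3^(k+1), since F is multiplied by 3 and a can be cancelled.
    Taking equal data for every n gives uniqueness. *)
Lemma unit_equation_continuous n (a a' : Z3) (F F' : Z3 -> Z3) (x x' : Z3) :
  a 1%N != 0%N -> a n = a' n ->
  (forall k y y', (k <= n)%N -> y k = y' k -> F y k = F' y' k) ->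
  a * x = 1 + 3 * F x -> a' * x' = 1 + 3 * F' x' -> x n = x' n.
Proof.
move=> a1 aa' FF' xE xE'.
suff xx' k : (k <= n)%N -> x k = x' k by exact: xx'.
elim: k => [_|k IHk kn].
  by rewrite -[LHS]residue_mod -[RHS]residue_mod !modn1.
apply: (residue_eq_mulI a1); rewrite xE.
rewrite (residue_eqM (residue_eq_leq kn aa') (erefl (x' k.+1))) xE'.
apply: residue_eqD => //; apply: residue_eq_3M.
by apply: FF'; [exact: ltnW | apply: IHk; exact: ltnW].
Qed.

Lemma natZ3_inv m : ~~ (3 %| m)%N -> exists y, m%:R * y = 1 :> Z3.
Proof.
move=> m3; have [||y] := @unit_equation_ex m%:R (fun=> 0) => //.
  by rewrite residue_nat.
by rewrite mulr0 addr0; exists y.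
Qed.

(** * The factor of iota_q(z) - z cutting out the nontrivial fixed points *)

Definition partial_sum3 (t : nat -> Z3) (N : nat) : Z3 :=
  \sum_(j < N) 3 ^+ j./2 * t j.

Lemma partial_sum3_stable t n N :
  (n.*2 <= N)%N -> partial_sum3 t N n = partial_sum3 t n.*2 n.
Proof.
move=> /subnKC <-; elim: (N - n.*2)%N => [|k IHk]; first by rewrite addn0.
have term0 : (3 ^+ (n.*2 + k)./2 * t (n.*2 + k)%N) n = 0%N.
  have nk : (n <= (n.*2 + k)./2)%N by lia.
  rewrite (residue_leq _ nk) -[X in residue _ X]add0n residue_pow3M.
  by rewrite -(residue_mod (t _) 0) modn1 muln0 mod0n.
rewrite addnS /partial_sum3 big_ord_recr residueD term0 addn0.
by rewrite residue_mod; exact: IHk.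
Qed.

Lemma series3_compatible t n :
  (partial_sum3 t n.+1.*2 n.+1 = partial_sum3 t n.*2 n %[mod 3 ^ n])%N.
Proof. by rewrite residueS partial_sum3_stable // leq_double. Qed.

Definition series3 t : Z3 := of_compatible (series3_compatible t).

Lemma series3E t n N : (n.*2 <= N)%N -> series3 t n = partial_sum3 t N n.
Proof. by move=> nN; rewrite /= residue_mod (partial_sum3_stable t nN). Qed.

(** Legendre's formula, summed using 2 c + max(1, c) <= max(1, b) for c = floor(b/3); the surviving
    1 makes the bound strict. *)
Lemma logn3_fact n : (0 < n)%N -> ((logn 3 n`!).*2 < n)%N.
Proof.
move=> n0; rewrite logn_fact //.
suff : ((\sum_(1 <= k < n.+1) n %/ 3 ^ k).*2 + maxn 1 (n %/ 3 ^ n) <= n)%N.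
  by apply: leq_trans; rewrite -addn1 leq_add2l leq_maxl.
elim: {1 4}n => [|m IHm].
  by rewrite big_geq // expn0 divn1; lia.
rewrite big_nat_recr //= expnS mulnC divnMA.
move: IHm; set S := (\sum_(1 <= k < _) _)%N; set b := (n %/ 3 ^ m)%N; lia.
Qed.

Lemma tail_coef_ex j : exists f : Z3,
  (j.+4)`!%:R * (3 * 3 ^+ j./2) * f = 2 * 3 ^+ j.+2.
Proof.
have [|m m3 mE] := @pfactor_coprime 3 (j.+4)`! isT; first exact: fact_gt0.
have [|y yE] := @natZ3_inv m; first by rewrite -prime_coprime.
have := @logn3_fact j.+4 isT; set v := logn _ _ in mE * => vj.
(* No subtraction truncates here: 2v < j+4 leaves at least 1 + floor(j/2) factors 3 after division
   by (j+4)!. *)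
have vE : (v + (1 + j./2) + (j.+2 - v - (1 + j./2)) = j.+2)%N by lia.
exists (2 * 3 ^+ (j.+2 - v - (1 + j./2)) * y).
rewrite -[in RHS]vE !exprD mE natrM natrX expr1.
rewrite -[RHS]mulr1 -[X in _ = _ * X]yE; ring.
Qed.

(* [3 * 3 ^+ j./2 * tail_coef j] is 2 3^(j+2) / (j+4)!; the power of 3 taken  *)
(* out is the one that makes [series3] converge.                              *)
Definition tail_coef j : Z3 :=
  get [set f : Z3 | (j.+4)`!%:R * (3 * 3 ^+ j./2) * f = 2 * 3 ^+ j.+2].

Lemma tail_coefP j :
  (j.+4)`!%:R * (3 * 3 ^+ j./2) * tail_coef j = 2 * 3 ^+ j.+2.
Proof. exact: (getPex (tail_coef_ex j)). Qed.

Definition tail_term w u j : Z3 :=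
  tail_coef j * (\prod_(i < j.+2) (- w - i%:R)) * u ^+ j.+2.

Definition tail w u : Z3 := series3 (tail_term w u).

Lemma residue_eq_tail n (w w' u u' : Z3) :
  w n = w' n -> u n = u' n -> tail w u n = tail w' u' n.
Proof.
move=> ww' uu'; rewrite !(series3E _ (leqnn _)).
apply: (@residue_eq_sum _ _ (fun j => 3 ^+ j./2 * tail_term w u j)
  (fun j => 3 ^+ j./2 * tail_term w' u' j)) => j; apply: residue_eqM => //.
apply: residue_eqM; last exact: residue_eqX.
apply: residue_eqM => //.
apply: (@residue_eq_prod _ _ (fun i => - w - i%:R) (fun i => - w' - i%:R)) => i.
by apply: residue_eqD => //; exact: residue_eqN.
Qed.

(** * Binomial expansion of iota_q *)

Lemma natr_ffact (A : comNzRingType) (n m : nat) :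
  (n ^_ m)%:R = \prod_(i < m) (n%:R - i%:R) :> A.
Proof.
elim: m => [|m IHm]; first by rewrite ffactn0 big_ord0.
rewrite ffactnSr big_ord_recr /= -IHm natrM.
have [nm|mn] := ltnP n m; first by rewrite ffact_small // !mul0r.
by rewrite natrB.
Qed.

Lemma geometric_sum_binomial (A : comNzRingType) (x : A) n N : (n <= N)%N ->
  \sum_(i < n) (1 + x) ^+ i = \sum_(k < N) x ^+ k *+ 'C(n, k.+1).
Proof.
elim: n => [_|n IHn nN].
  by rewrite big_ord0 big1 // => k _; rewrite bin0n mulr0n.
rewrite big_ord_recr /= IHn; last exact: ltnW.
under [RHS]eq_bigr do rewrite binS mulrnDr.
rewrite big_split /=; congr (_ + _).
rewrite addrC exprD1n (big_ord_widen N (fun i => x ^+ i *+ 'C(n, i)) nN).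
rewrite big_mkcond; apply: eq_bigr => k _; case: ifPn => //.
by rewrite -leqNgt => nk; rewrite bin_small ?mulr0n.
Qed.

Lemma tail_termE n u j :
  2 * ((3 * u) ^+ j.+3 *+ 'C(n, j.+4)) =
  3 * u * (n%:R * (n%:R - 1)) * (3 * (3 ^+ j./2 * tail_term (2 - n%:R) u j)).
Proof.
have ffactE : n%:R * (n%:R - 1) * \prod_(i < j.+2) (- (2 - n%:R) - i%:R) =
    (n ^_ j.+4)%:R :> Z3.
  rewrite natr_ffact [RHS]big_ord_recl [in RHS]big_ord_recl /= subr0 [RHS]mulrA.
  congr (_ * _).
  by apply: eq_bigr => i _; rewrite /= /bump /= !add1n -!natr1; ring.
transitivity ((2 * 3 ^+ j.+2) * (3 * u ^+ j.+3 * 'C(n, j.+4)%:R)).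
  by rewrite -mulr_natr exprMn [3 ^+ j.+3]exprS; ring.
rewrite -tail_coefP /tail_term.
transitivity (3 * u * (n ^_ j.+4)%:R *
  (3 * (3 ^+ j./2 * (tail_coef j * u ^+ j.+2)))).
  by rewrite -bin_ffact natrM [u ^+ j.+3]exprS; ring.
by rewrite -ffactE; ring.
Qed.

(** The first binomial term is n, the next two give 1 - (2 - n) u, and the others give the tail. The
    factor 2 clears the denominators: 2 * 9 / 3! = 3. *)
Lemma geometric_sum_tail n u N : (n <= N)%N ->
  2 * (\sum_(i < n) (1 + 3 * u) ^+ i - n%:R) =
  3 * u * (n%:R * (n%:R - 1)) *
    (1 - (2 - n%:R) * u + 3 * partial_sum3 (tail_term (2 - n%:R) u) N).
Proof.
move=> nN; have nN3 : (n <= N.+3)%N by rewrite -addn3 (leq_trans nN) ?leq_addr.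
pose S := \sum_(j < N) (3 * u) ^+ j.+3 *+ 'C(n, j.+4).
have -> : \sum_(i < n) (1 + 3 * u) ^+ i =
    n%:R + (3 * u * 'C(n, 2)%:R + ((3 * u) ^+ 2 * 'C(n, 3)%:R + S)).
  rewrite (geometric_sum_binomial _ nN3) 3!big_ord_recl !mulr_natr bin1.
  by congr (_ + (_ + (_ + _))); apply: eq_bigr.
have C2 : 'C(n, 2)%:R * 2 = n%:R * (n%:R - 1) :> Z3.
  have := bin_ffact n 2; rewrite -[2`!%N]/2%N => /(congr1 (fun k => k%:R : Z3)).
  by rewrite natrM natr_ffact !big_ord_recl big_ord0 /= subr0 mulr1.
have C3 : 'C(n, 3)%:R * 6 = n%:R * (n%:R - 1) * (n%:R - 2) :> Z3.
  have := bin_ffact n 3; rewrite -[3`!%N]/6%N => /(congr1 (fun k => k%:R : Z3)).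
  by rewrite natrM natr_ffact !big_ord_recl big_ord0 /= subr0 mulr1 !mulrA.
have SE : 2 * S = 3 * u * (n%:R * (n%:R - 1)) *
    (3 * partial_sum3 (tail_term (2 - n%:R) u) N).
  rewrite /S /partial_sum3 !big_distrr /=.
  by apply: eq_bigr => j _; rewrite -tail_termE.
transitivity (2 * S + 3 * u * ('C(n, 2)%:R * 2) +
  3 * u ^+ 2 * ('C(n, 3)%:R * 6)).
  ring.
by rewrite SE C2 C3; ring.
Qed.

Lemma iota_tail u z :
  2 * (iota_q (1 + 3 * u) z - z) =
  3 * u * (z * (z - 1)) * (1 - (2 - z) * u + 3 * tail (2 - z) u).
Proof.
have [|/continuous_Z3P iC iE] := @iota_qP (1 + 3 * u); first by exists u.
apply: Z3_ext => m.
have [i iP] := iC z m; pose n := z (maxn i m).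
have zn k : (k <= maxn i m)%N -> (n%:R : Z3) k = z k.
  by move=> /(residue_leq z) ->; rewrite residue_nat.
have znm := zn _ (leq_maxr i m).
rewrite -(@residue_eqM m 2 _ (iota_q (1 + 3 * u) n%:R - n%:R)) //; last first.
  apply: residue_eqD; first exact: (iP _ (zn _ (leq_maxl i m))).
  exact: residue_eqN.
have wm : (2 - n%:R : Z3) m = (2 - z) m.
  by apply: residue_eqD => //; exact: residue_eqN.
(* The length must reach n for the binomial sum to be complete, and 2m for the partial sum to equal
   the series mod 3^m. *)
rewrite iE (@geometric_sum_tail n u (maxn n m.*2)) ?leq_maxl //.
apply: residue_eqM.
  by do 2 apply: residue_eqM => //; exact: residue_eqD.
apply: residue_eqD.
  by apply: residue_eqD => //; apply: residue_eqN; exact: residue_eqM.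
apply: residue_eqM => //.
by rewrite -(residue_eq_tail wm (erefl (u m))) (series3E _ (leq_maxr n m.*2)).
Qed.

(** * Matching fixed points and units *)

Lemma residue_classP a m x : residue_class a m x <-> x m = a m.
Proof.
split=> [[y _ <-]|xa].
  apply/residue_eqB; rewrite addrC addKr -[X in residue _ X]add0n.
  by rewrite residue_pow3M -residue_mod modn1 muln0.
have /residue_eqB/residue_eq0_pow3[w wE] := xa.
by exists w => //; rewrite -wE addrC subrK.
Qed.

Lemma residue_lt3 x : (x 1%N < 3)%N.
Proof. by rewrite -residue_mod ltn_mod. Qed.

Lemma residue_opp x n : (- x) n = ((3 ^ n - x n) %% 3 ^ n)%N.
Proof. by []. Qed.

Lemma PsiDomP z : PsiDom z <-> (2 - z) 1%N != 0%N.
Proof.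
rewrite residueD residue_opp (residue_nat 2).
have -> : PsiDom z <-> z 1%N = 0%N \/ z 1%N = 1%N.
  by rewrite -(residue_classP 0 1 z) -(residue_classP 1 1 z).
by case: (z 1%N) (residue_lt3 z) => [|[|[|]]] //= _;
  split=> //; [left|right|case].
Qed.

Lemma residue2_1D3 u : (1 + 3 * u) 2%N = (1 + 3 * u 1)%N.
Proof.
rewrite residueD residue_3M (residue_nat 1) -[(3 ^ 2)%N]/9%N.
by have := residue_lt3 u; lia.
Qed.

Lemma residue_1D3_inj n (u u' : Z3) :
  (1 + 3 * u) n.+1 = (1 + 3 * u') n.+1 -> u n = u' n.
Proof.
move=> /residue_eqB uu'; apply/residue_eqB; apply/eqP.
have := residue_3M n (u - u').
rewrite (_ : 3 * (u - u') = 1 + 3 * u - (1 + 3 * u')); last by ring.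
by rewrite uu' => /esym/eqP; rewrite muln_eq0.
Qed.

Lemma PsiCodP q : PsiCod q <-> exists2 u, q = 1 + 3 * u & u 1%N != 0%N.
Proof.
split=> [[[u _ <-] q2]|[u -> u1]].
  exists u; rewrite ?expr1 //; apply: contra_not_neq q2 => u1.
  by apply/residue_classP; rewrite expr1 residue2_1D3 u1 (residue_nat 1).
split; first by exists u.
move=> /residue_classP; rewrite residue2_1D3 (residue_nat 1).
by move=> [] /eqP; rewrite muln_eq0 (negPf u1).
Qed.

Definition nontrivial_root z u := (2 - z) * u = 1 + 3 * tail (2 - z) u.

(** Modulo 3 the tail disappears and the equation becomes w u = 1, so both w and u are units. *)
Lemma residue1_mul z u :
  nontrivial_root z u -> ((2 - z)%R 1 * u 1 %% 3)%N = 1%N.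
Proof.
move=> /(congr1 (fun x : Z3 => x 1%N)); rewrite residueM (residueD 1).
by rewrite residue_3M (residue_nat 1) -(residue_mod _ 0) modn1 muln0.
Qed.

Lemma nontrivial_root_units z u :
  nontrivial_root z u -> (2 - z) 1%N != 0%N /\ u 1%N != 0%N.
Proof.
move=> /residue1_mul zu.
by split; apply: contra_eq_neq zu => ->; rewrite ?mul0n ?muln0 mod0n.
Qed.

Lemma fixed_pointP u z : u 1%N != 0%N ->
  fixed_point (1 + 3 * u) z <-> [\/ z = 0, z = 1 | nontrivial_root z u].
Proof.
move=> u1; rewrite /fixed_point /nontrivial_root; have := iota_tail u z.
set G := 1 - _ + _; have GE : G = 0 <-> (2 - z) * u = 1 + 3 * tail (2 - z) u.
  split=> [G0|zu]; last by rewrite /G zu; ring.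
  apply/eqP; rewrite -subr_eq0; apply/eqP; rewrite -oppr0 -G0 /G; ring.
move=> iE; split=> [iz|zP].
  move: iE; rewrite iz subrr mulr0 => /esym.
  case/mulZ3_eq0; last by move/GE; exact: Or33.
  case/mulZ3_eq0.
    case/mulZ3_eq0 => [/(congr1 (fun x : Z3 => x 2%N))|u0].
      by rewrite (residue_nat 3) /= mod0n.
    by rewrite u0 in u1.
  case/mulZ3_eq0 => [|/eqP]; first exact: Or31.
  by rewrite subr_eq0 => /eqP; exact: Or32.
have : 2 * (iota_q (1 + 3 * u) z - z) = 0.
  by rewrite iE; case: zP => [->|->|/GE ->]; rewrite ?subrr ?(mul0r, mulr0).
case/mulZ3_eq0 => [/(congr1 (fun x : Z3 => x 1%N))|/eqP].
  by rewrite (residue_nat 2) /= mod0n.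
by rewrite subr_eq0 => /eqP.
Qed.

Lemma nontrivial_root_continuous_unit n (z z' u u' : Z3) :
  nontrivial_root z u -> nontrivial_root z' u' -> z n = z' n -> u n = u' n.
Proof.
move=> zu zu' zz'; have [w1 _] := nontrivial_root_units zu.
have ww' : (2 - z) n = (2 - z') n.
  by apply: residue_eqD => //; exact: residue_eqN.
apply: (unit_equation_continuous w1 ww' _ zu zu') => k y y' kn.
exact: residue_eq_tail (residue_eq_leq kn ww').
Qed.

Lemma nontrivial_root_continuous n (z z' u u' : Z3) :
  nontrivial_root z u -> nontrivial_root z' u' -> u n = u' n -> z n = z' n.
Proof.
move=> zu zu' uu'; have [_ u1] := nontrivial_root_units zu.
suff ww' : (2 - z) n = (2 - z') n.
  rewrite -[z](subKr 2) -[z'](subKr 2).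
  by apply: residue_eqD => //; exact: residue_eqN.
move: zu zu'; rewrite /nontrivial_root ![_ * u]mulrC ![_ * u']mulrC.
apply: (@unit_equation_continuous n u u' (tail^~ u) (tail^~ u')) => //.
move=> k y y' kn yy'.
exact: residue_eq_tail yy' (residue_eq_leq kn uu').
Qed.

Lemma nontrivial_root_unit_ex z : PsiDom z -> exists u, nontrivial_root z u.
Proof.
move=> /PsiDomP /unit_equation_ex; apply=> n x y.
exact: residue_eq_tail.
Qed.

Lemma nontrivial_root_ex u : u 1%N != 0%N -> exists z, nontrivial_root z u.
Proof.
move=> u1; have [n x y xy|w wE] := @unit_equation_ex u (tail^~ u) u1.
  exact: residue_eq_tail.
by exists (2 - w); rewrite /nontrivial_root subKr mulrC.
Qed.

(** * The correspondence between z and q *)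

(** Unlike [fixed_point], which always holds at 0 and 1, this selects a single z for each q; z = 0
    or 1 occurs only when it is a root of the last factor. *)
Definition matched z q := exists2 u, q = 1 + 3 * u & nontrivial_root z u.

Lemma matched_Dom z q : matched z q -> PsiDom z.
Proof. by move=> [u _ /nontrivial_root_units[w1 _]]; apply/PsiDomP. Qed.

Lemma matched_Cod z q : matched z q -> PsiCod q.
Proof.
by move=> [u -> /nontrivial_root_units[_ u1]]; apply/PsiCodP; exists u.
Qed.

Lemma matched_ex z : PsiDom z -> exists q, matched z q.
Proof. by move=> /nontrivial_root_unit_ex[u zu]; exists (1 + 3 * u), u. Qed.

Lemma matched_fixed_ex q : PsiCod q -> exists z, matched z q.
Proof.
by move=> /PsiCodP[u -> /nontrivial_root_ex[z zu]]; exists z, u.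
Qed.

Lemma matched_continuous n (z z' q q' : Z3) :
  matched z q -> matched z' q' -> z n = z' n -> q n = q' n.
Proof.
move=> [u -> zu] [u' -> zu'] zz'; apply: residue_eqD => //.
by apply: residue_eqM => //; exact: nontrivial_root_continuous_unit zu zu' zz'.
Qed.

(** One digit is lost because q = 1 + 3u determines u mod 3^n only from q mod 3^(n+1). *)
Lemma matched_fixed_continuous n (z z' q q' : Z3) :
  matched z q -> matched z' q' -> q n.+1 = q' n.+1 -> z n = z' n.
Proof.
move=> [u -> zu] [u' -> zu'] /residue_1D3_inj.
exact: nontrivial_root_continuous zu zu'.
Qed.

Lemma matched_uniq z (q q' : Z3) : matched z q -> matched z q' -> q = q'.
Proof.
by move=> zq zq'; apply: Z3_ext => n; exact: matched_continuous zq zq' _.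
Qed.

Lemma matched_fixed_uniq (z z' : Z3) q : matched z q -> matched z' q -> z = z'.
Proof.
by move=> zq zq'; apply: Z3_ext => n; exact: matched_fixed_continuous zq zq' _.
Qed.

Lemma fixed_point_matched q z : PsiCod q ->
  fixed_point q z <-> [\/ z = 0, z = 1 | matched z q].
Proof.
move=> /PsiCodP[u -> u1]; rewrite fixed_pointP //.
split=> -[]; [exact: Or31|exact: Or32|move=> ?; apply: Or33; by exists u|
  exact: Or31|exact: Or32|].
move=> [v uv zv]; apply: Or33; suff -> : u = v by [].
by apply: Z3_ext => n; apply: residue_1D3_inj; rewrite uv.
Qed.

(** Some z is always matched with q and is a fixed point, so it must be 0 or 1; conversely,
    uniqueness of that z excludes any other. *)
Lemma no_nontrivial_fixed_pointP q : PsiCod q ->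
  no_nontrivial_fixed_point q <-> matched 0 q \/ matched 1 q.
Proof.
move=> qC; split=> [nq|q01 z /(fixed_point_matched _ qC)[||zq]]; last 3 first.
- by left.
- by right.
- by case: q01 => /matched_fixed_uniq/(_ zq) <-; [left | right].
have [z zq] := matched_fixed_ex qC.
have [z0|z1] : z = 0 \/ z = 1; last 2 first.
- by left; rewrite -z0.
- by right; rewrite -z1.
by apply/nq/fixed_point_matched => //; exact: Or33.
Qed.

(** Here w = 2, so 2u = 1 mod 3 forces u = 2 mod 3. *)
Lemma matched0_residue q : matched 0 q -> q 2%N = 7%N.
Proof.
move=> [u -> /residue1_mul]; rewrite residue2_1D3 subr0 (residue_nat 2).
by have := residue_lt3 u; lia.
Qed.

Lemma matched1_residue q : matched 1 q -> q 2%N = 4%N.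
Proof.
move=> [u -> /residue1_mul]; rewrite residue2_1D3.
rewrite (_ : 2 - 1 = 1); last by ring.
by rewrite (residue_nat 1); have := residue_lt3 u; lia.
Qed.

Lemma matched_q0 q : matched 0 q -> q0 = q.
Proof.
move=> mq; have qC := matched_Cod mq.
have [q0C q07 /(no_nontrivial_fixed_pointP q0C)[m0|m1]] : [/\ PsiCod q0,
    residue_class 7 2 q0 & no_nontrivial_fixed_point q0].
- apply: (@getPex _ [set q | [/\ PsiCod q, residue_class 7 2 q
    & no_nontrivial_fixed_point q]]); exists q; split=> //.
    by apply/residue_classP; rewrite residue_nat; exact: matched0_residue.
  by apply/no_nontrivial_fixed_pointP => //; left.
- exact: matched_uniq m0 mq.
(* Being matched with 1 would put [q0] in the class of 4 mod 9, not 7. *)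
- move: q07 => /residue_classP; rewrite residue_nat.
  by rewrite (matched1_residue m1).
Qed.

Lemma matched_q1 q : matched 1 q -> q1 = q.
Proof.
move=> mq; have qC := matched_Cod mq.
have [q1C q14 /(no_nontrivial_fixed_pointP q1C)[m0|m1]] : [/\ PsiCod q1,
    residue_class 4 2 q1 & no_nontrivial_fixed_point q1].
- apply: (@getPex _ [set q | [/\ PsiCod q, residue_class 4 2 q
    & no_nontrivial_fixed_point q]]); exists q; split=> //.
    by apply/residue_classP; rewrite residue_nat; exact: matched1_residue.
  by apply/no_nontrivial_fixed_pointP => //; right.
- move: q14 => /residue_classP; rewrite residue_nat.
  by rewrite (matched0_residue m0).
- exact: matched_uniq m1 mq.
Qed.

Lemma continuous_set_typeP (A B : set Z3) (f : set_type A -> set_type B) :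
  (forall (x : set_type A) n, exists m, forall y : set_type A,
     set_val y m = set_val x m -> set_val (f y) n = set_val (f x) n) ->
  continuous f.
Proof.
move=> fP; apply: continuous_comp_initial => x U /nbhs_Z3P[n nU].
have [m mP] := fP x n.
have : nbhs (set_val x) [set y : Z3 | y m = set_val x m].
  by apply/nbhs_Z3P; exists m.
move=> /(@initial_continuous (set_type A) Z3 set_val x) /=.
rewrite !nbhs_simpl => xm; apply: (@filterS _ (nbhs x) _ _ _ _ xm) => y /= ym.
by apply: nU; exact: mP.
Qed.

Theorem theorem6p1 :
  (forall z : Z3, PsiDom z -> z <> 0 -> z <> 1 ->
     exists! q : Z3, PsiCod q /\ iota_q q z = z) /\
  (exists Psi : set_type PsiDom -> set_type PsiCod,
     [/\ homeomorphism Psi,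
         forall z : set_type PsiDom, set_val z = 0 -> set_val (Psi z) = q0,
         forall z : set_type PsiDom, set_val z = 1 -> set_val (Psi z) = q1
       & forall z : set_type PsiDom, set_val z <> 0 -> set_val z <> 1 ->
           iota_q (set_val (Psi z)) (set_val z) = set_val z]).
Proof.
split=> [z zD z0 z1|].
  have [q zq] := matched_ex zD; exists q; split=> [|q' [q'C]].
    split; first exact: matched_Cod zq.
    by apply/(fixed_point_matched _ (matched_Cod zq)); exact: Or33.
  by move=> /(fixed_point_matched _ q'C)[//|//|]; exact: matched_uniq.
have /choice[Psi PsiP] (z : set_type PsiDom) :
    exists q : set_type PsiCod, matched (set_val z) (set_val q).
  have [q zq] := matched_ex (set_mem (valP z)).
  by exists (SigSub (mem_set (matched_Cod zq))).
have /choice[Phi PhiP] (q : set_type PsiCod) :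
    exists z : set_type PsiDom, matched (set_val z) (set_val q).
  have [z zq] := matched_fixed_ex (set_mem (valP q)).
  by exists (SigSub (mem_set (matched_Dom zq))).
exists Psi; split.
- exists Phi; split.
  + by move=> z; apply: val_inj; exact: matched_fixed_uniq (PhiP _) (PsiP _).
  + by move=> q; apply: val_inj; exact: matched_uniq (PsiP _) (PhiP _).
  + apply: continuous_set_typeP => x n; exists n => y.
    exact: matched_continuous (PsiP _) (PsiP _).
  + apply: continuous_set_typeP => x n; exists n.+1 => y.
    exact: matched_fixed_continuous (PhiP _) (PhiP _).
- by move=> z z0; rewrite (@matched_q0 (set_val (Psi z))) // -z0.
- by move=> z z1; rewrite (@matched_q1 (set_val (Psi z))) // -z1.
- move=> z _ _; have zq := PsiP z.
  by apply/(fixed_point_matched _ (matched_Cod zq)); exact: Or33.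
Qed.
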